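(* Let $n\ge 1$ and let $a_{0},a_{1},\dots,a_{n}$ be integers with $a_0a_n\neq 0$. For $j\in\{0,1,2\}$ let $$S_{j}=\sum_{\substack{0\le i\le n\\ i\equiv j\ (\mathrm{mod}\ 3)}}a_{i},$$ and suppose that $S_0^2+S_1^2+S_2^2-S_0S_1-S_0S_2-S_1S_2=p\cdot q$, where $p$ is a prime number and $q$ is a positive integer. If $$|a_0|>\sum_{i=1}^{n}|a_{i}|\left(\frac{1+\sqrt{4q+5}}{2}\right)^i,$$ then the polynomial $\sum_{i=0}^{n}a_{i}X^{i}$ is irreducible over $\mathbb{Q}$. *)

(* Defs.v *)
From mathcomp Require Import all_boot all_order all_algebra.

Set Implicit Arguments.
Unset Strict Implicit.
Unset Printing Implicit Defensive.

Import GRing.Theory Num.Theory.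
Local Open Scope ring_scope.

(* Only the values a 0, ..., a n are used. *)
Definition residue_sum (n : nat) (a : nat -> int) (j : nat) : int :=
  \sum_(i < n.+1 | (i == j %[mod 3])%N) a i.

(* Main.v *)
Require Import Defs.
From mathcomp Require Import all_boot all_order all_algebra.
From mathcomp Require Import reals ring complex.

(** Let [w] be a primitive cube root of unity and [f] the polynomial of the
    theorem. Modulo [X^2 + X + 1] only the residue sums survive, so the given
    quadratic form is the norm [f(w) f(w')] of the Eisenstein integer [f(w)]
    (lemma [enorm_residue]). This norm is multiplicative in the polynomial.

    By the lemma of Gauss a nontrivial factorisation of [f] over the rationals
    gives [f = g h] with [g] and [h] nonconstant over the integers, so that the
    norms of [g] and [h] are natural numbers with product [p q]. As [p] is
    prime it divides one of the two norms, and the other one is then at most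
    [q]. On the other hand, the hypothesis on [a 0] forces every complex root
    of [f] to have modulus larger than [B = (1 + sqrt (4 q + 5)) / 2] (lemma
    [root_norm_gt]). Since [B] is the positive root of [t^2 - t - 1 = q], every
    nonconstant integer factor of [f] has norm larger than [q] (lemma
    [enorm_gt]), a contradiction.

    The complex numbers are [R[i]], for the given field [R] of reals. *)

Set Implicit Arguments.
Unset Strict Implicit.
Unset Printing Implicit Defensive.

Import Order.TTheory GRing.Theory Num.Theory.
Local Open Scope ring_scope.

Lemma map_intr_poly (T : nzRingType) n (a : nat -> int) :
  map_poly intr (\poly_(i < n) a i) = \poly_(i < n) (a i)%:~R :> {poly T}.
Proof. by apply/polyP => i; rewrite coef_map !coef_poly; case: ifP. Qed.

(** Otherwise the nonconstant terms at [z], of total size at most the left-hand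
    side of the hypothesis, would have to cancel [a 0]. *)
Lemma root_norm_gt (C : numClosedFieldType) (n : nat) (a : nat -> C) (B z : C) :
  0 <= B -> \sum_(1 <= i < n.+1) `|a i| * B ^+ i < `|a 0%N| ->
  root (\poly_(i < n.+1) a i) z -> B < `|z|.
Proof.
move=> B0 dom /rootP; rewrite horner_poly => z0.
rewrite real_ltNge ?normr_real ?ger0_real //; apply/negP => zB.
suff : `|a 0%N| <= \sum_(1 <= i < n.+1) `|a i| * B ^+ i by rewrite lt_geF.
move: z0; rewrite -(big_mkord xpredT (fun i => a i * z ^+ i)) big_ltn // expr0 mulr1.
move/eqP; rewrite addr_eq0 => /eqP ->; rewrite normrN.
apply: le_trans (ler_norm_sum _ _ _) _; apply: ler_sum => i _.
by rewrite normrM ler_wpM2l // normrX lerXn2r // nnegrE.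
Qed.

Section EisensteinNorm.

Variables (C : numClosedFieldType) (w : C).
Hypothesis w_root : w ^+ 2 + w + 1 = 0.

(** The norm over [Q] of the Eisenstein integer [h.[w]]; [-1 - w] is the other
    root of [X^2 + X + 1]. *)
Definition enorm (h : {poly int}) : C :=
  (map_poly intr h).[w] * (map_poly intr h).[-1 - w].

Lemma enormM g h : enorm (g * h) = enorm g * enorm h.
Proof. by rewrite /enorm rmorphM !hornerM /=; ring. Qed.

Lemma w_sqr : w ^+ 2 = -1 - w.
Proof. by apply/eqP; rewrite -subr_eq0 -w_root; apply/eqP; ring. Qed.

Lemma conj_root : (-1 - w) ^+ 2 + (-1 - w) + 1 = 0.
Proof. by rewrite -w_root; ring. Qed.

(** Reduction modulo [X^2 + X + 1]; the same [c] and [d] must serve both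
    cube roots of unity for the norm to be computed from them. *)
Lemma horner_linear (h : {poly int}) : exists c d : int,
  forall z : C, z ^+ 2 + z + 1 = 0 -> (map_poly intr h).[z] = c%:~R + d%:~R * z.
Proof.
elim/poly_ind: h => [|h k [c [d IH]]].
  by exists 0, 0 => z _; rewrite rmorph0 horner0 mul0r addr0.
exists (k - d), (c - d) => z z0.
rewrite rmorphD rmorphM /= map_polyX map_polyC /= hornerMXaddC IH // !rmorphB /=.
apply/eqP; rewrite -subr_eq0; apply/eqP.
transitivity (d%:~R * (z ^+ 2 + z + 1)); first by ring.
by rewrite z0 mulr0.
Qed.

Lemma enorm_lin (x y : C) :
  (x + y * w) * (x + y * (-1 - w)) = x ^+ 2 - x * y + y ^+ 2.
Proof.
apply/eqP; rewrite -subr_eq0; apply/eqP.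
transitivity (- y ^+ 2 * (w ^+ 2 + w + 1)); first by ring.
by rewrite w_root mulr0.
Qed.

(** Norms of Eisenstein integers are values of the positive definite form
    [c^2 - c d + d^2]; the factorisation argument is thus carried out in [nat]. *)
Lemma enorm_nat h : exists m : nat, enorm h = m%:R.
Proof.
have [c [d E]] := horner_linear h.
rewrite /enorm !E // ?conj_root // enorm_lin.
have ge0 : 0 <= c ^+ 2 - c * d + d ^+ 2.
  (* a sum of squares plus [c * d], and also a sum of squares minus [c * d] *)
  have -> : c ^+ 2 - c * d + d ^+ 2 = (c - d) ^+ 2 + c * d by ring.
  have [cd|cd] := leP 0 (c * d); first by rewrite addr_ge0 ?sqr_ge0.
  rewrite (_ : _ + _ = c ^+ 2 - c * d + d ^+ 2); last by ring.
  by rewrite !addr_ge0 ?sqr_ge0 // oppr_ge0 ltW.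
exists (absz (c ^+ 2 - c * d + d ^+ 2)).
by rewrite pmulrn gez0_abs // rmorphD rmorphB (rmorphM _ c d) !rmorphXn.
Qed.

(** Since [z ^+ 3 = 1], the value at [z] only depends on the sums of the
    coefficients over the residue classes modulo 3. *)
Lemma enorm_residue n (a : nat -> int) :
  let S := residue_sum n a in
  enorm (\poly_(i < n.+1) a i) =
  (S 0%N ^+ 2 + S 1%N ^+ 2 + S 2%N ^+ 2
          - S 0%N * S 1%N - S 0%N * S 2%N - S 1%N * S 2%N)%:~R.
Proof.
move=> S.
have E (z : C) : z ^+ 2 + z + 1 = 0 -> (map_poly intr (\poly_(i < n.+1) a i)).[z] =
    (S 0%N)%:~R + (S 1%N)%:~R * z + (S 2%N)%:~R * z ^+ 2.
  move=> z0; have z3 : z ^+ 3 = 1.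
    apply/eqP; rewrite -subr_eq0; apply/eqP.
    transitivity ((z - 1) * (z ^+ 2 + z + 1)); first by ring.
    by rewrite z0 mulr0.
  have Sj (j : 'I_3) : \sum_(i < n.+1 | inord (i %% 3) == j) (a i)%:~R * z ^+ i =
      (S j)%:~R * z ^+ j.
    rewrite /S /residue_sum rmorph_sum mulr_suml /=.
    apply: eq_big => i.
      by rewrite -val_eqE /= inordK ?ltn_mod // (modn_small (ltn_ord j)).
    move/eqP=> <-; rewrite inordK ?ltn_mod //.
    by rewrite (expr_mod _ z3).
  rewrite map_intr_poly horner_poly.
  rewrite (partition_big (fun i : 'I_n.+1 => inord (i %% 3) : 'I_3) xpredT) //=.
  under eq_bigr do rewrite Sj.
  by rewrite !big_ord_recr big_ord0 /= add0r mulr1.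
rewrite /enorm !E ?conj_root // w_sqr.
have -> : (-1 - w) ^+ 2 = w.
  by apply: (addIr (-1 - w + 1)); rewrite addrA conj_root; ring.
rewrite !(rmorphD, rmorphB, rmorphM, rmorphXn) /=.
set x := (S 0%N)%:~R; set y := (S 1%N)%:~R; set z := (S 2)%:~R.
transitivity ((x - z + (y - z) * w) * (x - z + (y - z) * (-1 - w))); first by ring.
by rewrite enorm_lin; ring.
Qed.

(** The norm is the resultant with [X^2 + X + 1]: up to the square of the
    leading coefficient, a nonzero integer, it is the product over the complex
    roots [z] of [z^2 + z + 1], and each factor has modulus at least
    [`|z|^2 - `|z| - 1 > B^2 - B - 1 = q]. Comparing the factors [w - z]
    and [-1 - w - z] separately with [`|z| - 1] would only give [(B - 1)^2],
    which is less than [q] for large [q]. *)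
Lemma enorm_gt (h : {poly int}) (q : nat) (B : C) :
  1 <= B -> B ^+ 2 - B - 1 = q%:R -> (0 < q)%N -> (1 < size h)%N ->
  (forall z, root (map_poly intr h) z -> B < `|z|) ->
  q%:R < enorm h.
Proof.
move=> B1 Bq q0 h1 hroot.
have [r Er] := closed_field_poly_normal (map_poly intr h : {poly C}).
have lc_neq0 : (lead_coef h)%:~R != 0 :> C.
  by rewrite intr_eq0 lead_coef_eq0 -size_poly_gt0 ltnW.
rewrite lead_coef_map_eq // in Er.
have szh : size (map_poly intr h : {poly C}) = size h by rewrite size_map_poly_id0.
have r0 : r != [::].
  by apply: contraTneq h1 => r0; rewrite -szh Er r0 big_nil size_scale // size_poly1.
have [m Em] := enorm_nat h.
suff : q%:R < `|enorm h| by rewrite Em normr_nat.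
have rgt z : z \in r -> q%:R < `|(w - z) * (-1 - w - z)|.
  move=> zr; have Bz : B < `|z|.
    by apply: hroot; rewrite Er rootZ // root_prod_XsubC.
  have -> : (w - z) * (-1 - w - z) = z ^+ 2 + z + 1.
    apply/eqP; rewrite -subr_eq0; apply/eqP.
    by transitivity (- (w ^+ 2 + w + 1)); [ring | rewrite w_root oppr0].
  apply: (@lt_le_trans _ _ (`|z| ^+ 2 - `|z| - 1)).
    rewrite -Bq -subr_gt0.
    (* [1 - B] is the other root of [t^2 - t - 1 - q] *)
    have -> : `|z| ^+ 2 - `|z| - 1 - (B ^+ 2 - B - 1) = (`|z| - B) * (`|z| + (B - 1)).
      by ring.
    rewrite mulr_gt0 ?subr_gt0 // ltr_wpDr ?subr_ge0 //.
    exact: le_lt_trans (le_trans ler01 B1) Bz.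
  rewrite !lerBlDr -normrX -addrA.
  have {1}-> : z ^+ 2 = (z ^+ 2 + z + 1) - (z + 1) by ring.
  apply: (le_trans (ler_normB _ _)); rewrite lerD2l.
  by rewrite addrC (le_trans (ler_normD _ _)) // normr1 addrC.
rewrite /enorm Er !hornerZ !horner_prod.
under eq_bigr do rewrite hornerXsubC.
under [X in _ * (_ * X)]eq_bigr do rewrite hornerXsubC.
rewrite mulrACA -big_split /= normrM normr_prod.
have lc1 : 1 <= `|(lead_coef h)%:~R * (lead_coef h)%:~R : C|.
  rewrite -rmorphM /= -intr_norm ler1z -gtz0_ge1 normr_gt0 mulf_neq0 //.
    by rewrite -(intr_eq0 C).
  by rewrite -(intr_eq0 C).
apply: (@lt_le_trans _ _ (\prod_(i <- r) `|(w - i) * (-1 - w - i)|)); last first.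
  by rewrite ler_peMl // prodr_ge0.
have q1 : 1 <= q%:R :> C by rewrite ler1n.
case: r r0 rgt {Er} => // z r _ rgt.
rewrite big_cons; apply: (lt_le_trans (rgt z (mem_head _ _))).
rewrite ler_peMr //.
rewrite big_seq; elim/big_ind: _ => // [x y x1 y1|i ir].
  by rewrite -[1]mulr1 ler_pM.
by rewrite (le_trans q1) // ltW // rgt // in_cons ir orbT.
Qed.

(** By the lemma of Gauss a rational factorisation comes from an integral one.
    The prime [p] divides the norm of one factor, so the other factor has norm
    at most [q]; by the root bound and [enorm_gt] this factor is constant. *)
Lemma irreducible_of_enorm (F : {poly int}) (p q : nat) (B : C) :
  prime p -> (0 < q)%N -> 1 <= B -> B ^+ 2 - B - 1 = q%:R ->
  (1 < size F)%N -> enorm F = (p * q)%:R ->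
  (forall z, root (map_poly intr F) z -> B < `|z|) ->
  irreducible_poly (map_poly intr F : {poly rat}).
Proof.
move=> p_pr q0 B1 Bq F1 NF hroot.
have szQ (h : {poly int}) : size (map_poly intr h : {poly rat}) = size h.
  by rewrite size_map_inj_poly //; exact: intr_inj.
split=> [|Q]; first by rewrite szQ.
move=> Q1 QF; case: (dvdpP_rat_int QF) => g [b b0 EQ] [r EF].
rewrite -dvdp_size_eqp // szQ EQ size_scale // szQ {QF}.
have g1 : size g != 1%N by rewrite EQ size_scale // szQ in Q1.
have : g * r != 0 by rewrite -EF -size_poly_gt0 ltnW.
rewrite mulf_eq0 => /norP[g0 r0].
have [r1|r1] := eqVneq (size r) 1%N.
  by rewrite EF size_mul // r1 addn1.
have size_gt1 (h : {poly int}) : h != 0 -> size h != 1%N -> (1 < size h)%N.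
  by rewrite -size_poly_gt0; case: (size h) => [|[]].
have Ng : q%:R < enorm g.
  apply: (enorm_gt B1 Bq) => // [|z gz]; first exact: size_gt1.
  by apply: hroot; rewrite EF rmorphM rootM gz.
have Nr : q%:R < enorm r.
  apply: (enorm_gt B1 Bq) => // [|z rz]; first exact: size_gt1.
  by apply: hroot; rewrite EF rmorphM rootM rz orbT.
have [m Em] := enorm_nat g; have [k Ek] := enorm_nat r.
rewrite Em ltr_nat in Ng; rewrite Ek ltr_nat in Nr.
move: NF; rewrite EF enormM Em Ek -natrM => /eqP; rewrite eqr_nat => /eqP mk.
(* a cofactor larger than [q] leaves no room for [p] *)
have not_dvd x y : (q < y)%N -> (x * y = p * q)%N -> ~~ (p %| x)%N.
  move=> qy xy; apply/negP => /dvdnP[c Ex].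
  have cy : (c * y = q)%N.
    by apply/eqP; rewrite -(eqn_pmul2l (prime_gt0 p_pr)) -xy Ex mulnCA mulnA.
  have c0 : (0 < c)%N by case: c cy {Ex} => // cy; rewrite -cy in q0.
  by move: qy; rewrite ltnNge -cy leq_pmull.
have : (p %| m * k)%N by rewrite mk dvdn_mulr.
rewrite Euclid_dvdM // (negPf (not_dvd _ _ Nr mk)) /=.
by rewrite (negPf (not_dvd _ _ Ng _)) // mulnC.
Qed.

End EisensteinNorm.

Lemma norm_real_complex (R : rcfType) (x : R) : `|x%:C%C| = `|x|%:C%C.
Proof. by rewrite normc_def /= expr0n addr0 sqrtr_sqr. Qed.

Theorem theorem5p7 (R : realType) (n : nat) (a : nat -> int) (p q : nat)
  (hn : (1 <= n)%N)
  (ha : a 0%N * a n != 0)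
  (hp : prime p)
  (hq : (0 < q)%N)
  (hS : let S := residue_sum n a in
        S 0%N ^+ 2 + S 1%N ^+ 2 + S 2%N ^+ 2
          - S 0%N * S 1%N - S 0%N * S 2%N - S 1%N * S 2%N = p%:Z * q%:Z)
  (hdom : `|(a 0%N)%:~R : R| >
          \sum_(1 <= i < n.+1)
            `|(a i)%:~R : R| * ((1 + Num.sqrt (4 * q%:R + 5)) / 2) ^+ i) :
  irreducible_poly (\poly_(i < n.+1) (a i)%:~R : {poly rat}).
Proof.
set B := _ / 2 in hdom.
have B1 : 1 <= B.
  rewrite ler_pdivlMr // mul1r -[2]/(1 + 1) lerD2l -{1}(sqrtr1 R).
  by rewrite ler_wsqrtr // -natrM -natrD ler1n addn_gt0 orbT.
have Bq : B ^+ 2 - B - 1 = q%:R.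
  have sq : Num.sqrt (4 * q%:R + 5) ^+ 2 = 4 * q%:R + 5 :> R.
    by rewrite sqr_sqrtr // addr_ge0 ?mulr_ge0 ?ler0n.
  rewrite /B; set t := Num.sqrt _ in sq *.
  transitivity ((t ^+ 2 - 5) / 4); first by field.
  by rewrite sq; field.
pose C := R[i]; pose w : C := (-1 + sqrtC (-3)) / 2.
have w_root : w ^+ 2 + w + 1 = 0.
  have sq : sqrtC (-3) ^+ 2 = -3 :> C by rewrite sqrtCK.
  rewrite /w; set t := sqrtC _ in sq *.
  transitivity ((t ^+ 2 + 3) / 4); first by field.
  by rewrite sq addNr mul0r.
have an : a n != 0 by apply: contraNneq ha => ->; rewrite mulr0.
rewrite -map_intr_poly.
apply: (irreducible_of_enorm w_root hp hq (B := B%:C%C)).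
- by rewrite -(rmorph1 (real_complex R)) lecR.
- rewrite -[1](rmorph1 (real_complex R)) -rmorphXn -!rmorphB /= Bq.
  by rewrite rmorph_nat.
- by rewrite size_poly_eq.
- by rewrite enorm_residue // hS -PoszM -pmulrn.
move=> z; rewrite map_intr_poly; apply: root_norm_gt.
  by rewrite -(rmorph0 (real_complex R)) lecR (le_trans ler01).
rewrite -ltcR rmorph_sum /= in hdom.
rewrite -(rmorph_int (real_complex R)) norm_real_complex.
under eq_bigr do rewrite -(rmorph_int (real_complex R)) norm_real_complex -rmorphXn -rmorphM.
exact: hdom.
Qed.
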